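(* Let problem (P) and the convex approximations $(\mathrm P_i)$ be as defined in the context. Let $\mathbf s^{\mathrm u}_0=(s^{\mathrm u}_{k,0})_k$ and $\mathbf s^{\mathrm d}_0=(s^{\mathrm d}_{k,0})_k$ be the $\mathbf s^{\mathrm u}$- and $\mathbf s^{\mathrm d}$-components of a feasible point of (P). For $i=1,2,\dots$, let $\mathbf x_i^*$ be an optimal solution of $(\mathrm P_i)$ (assumed to exist), where $(\mathrm P_i)$ is built from $\mathbf s^{\mathrm u}_{i-1},\mathbf s^{\mathrm d}_{i-1}$; let $\mathbf s^{\mathrm u}_i,\mathbf s^{\mathrm d}_i$ be the corresponding components of $\mathbf x_i^*$, and let $L^i$ be the optimal objective value of $(\mathrm P_i)$. The iterative algorithm computes $\mathbf x_1^*,\mathbf x_2^*,\dots$ in this way and outputs the last computed iterate $\mathbf x^*_i$. Then the output solution is feasible for (P), i.e. $\mathbf x_i^*$ is feasible for (P) for every $i\ge1$; and the algorithm converges, i.e. the sequence of objective values $(L^i)_{i\ge1}$ converges.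
   Context: Decision variables of both problems: $E^{\mathrm u}_k,E^{\mathrm c}_k,E^{\mathrm d}_k,t^{\mathrm u}_k,t^{\mathrm c}_k,t^{\mathrm d}_k,B_k,s^{\mathrm u}_k,s^{\mathrm d}_k>0$, $D_k\in\mathbb R$, and $l_k>\operatorname{tr}(\mathbf V_k\mathbf S_k)$, for $k=1,\dots,K$. Define $$D^{\mathrm u}_k=s^{\mathrm u}_k\log_2\left(1+\frac{g^{\mathrm u}_kE^{\mathrm u}_k}{s^{\mathrm u}_kN_0}\right),\quad D^{\mathrm c}_k=t^{\mathrm c}_k\left(\frac{E^{\mathrm c}_k}{\alpha^3\kappa t^{\mathrm c}_k}\right)^{1/3},\quad D^{\mathrm d}_k=s^{\mathrm d}_k\log_2\left(1+\frac{g^{\mathrm d}_kE^{\mathrm d}_k}{s^{\mathrm d}_kN_0}\right).$$ Common constraints (for all $k$ where applicable): $D_k\ge \log_2|\det\mathbf\Phi_k|+\frac{n_k}{2}\log_2\left(1+\frac{n_kN(\mathbf v_k)|\det\mathbf M_k|^{1/n_k}}{l_k-\operatorname{tr}(\mathbf V_k\mathbf S_k)}\right)$; $D_k\le\min\{\rho D^{\mathrm s}_k,\rho D^{\mathrm u}_k,\rho D^{\mathrm c}_k,D^{\mathrm d}_k\}$; $\sum_k B_k\le B_{\max}$; $t^{\mathrm u}_k+t^{\mathrm c}_k+t^{\mathrm d}_k\le T$; $\sum_k t^{\mathrm c}_k\le T$; $\sum_k\left(\frac{E^{\mathrm u}_k}{\eta^{\mathrm s}_k}+\frac{E^{\mathrm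 c}_k+E^{\mathrm d}_k}{\eta^{\mathrm e}}\right)\le P_0T$; $E^{\mathrm u}_k/t^{\mathrm u}_k\le P_{\mathrm{umax}}$, $E^{\mathrm d}_k/t^{\mathrm d}_k\le P_{\mathrm{dmax}}$, $\left(\frac{E^{\mathrm c}_k}{\kappa t^{\mathrm c}_k}\right)^{1/3}\le F_{\max}$. Problem (P): minimize $\sum_{k=1}^K l_k$ subject to the common constraints and $s^{\mathrm u}_k\le t^{\mathrm u}_kB_k$, $s^{\mathrm d}_k\le t^{\mathrm d}_kB_k$ for all $k$. Problem $(\mathrm P_i)$, given positive constants $s^{\mathrm u}_{k,i-1},s^{\mathrm d}_{k,i-1}$: minimize $\sum_{k=1}^K l_k$ subject to the common constraints and, for all $k$, $$\frac{s^{\mathrm u}_k-s^{\mathrm u}_{k,i-1}}{s^{\mathrm u}_{k,i-1}}+\ln s^{\mathrm u}_{k,i-1}-\ln t^{\mathrm u}_k-\ln B_k\le0,\qquad \frac{s^{\mathrm d}_k-s^{\mathrm d}_{k,i-1}}{s^{\mathrm d}_{k,i-1}}+\ln s^{\mathrm d}_{k,i-1}-\ln t^{\mathrm d}_k-\ln B_k\le0.$$ Constants: $K\ge1$ is an integer; $g^{\mathrm u}_k,g^{\mathrm d}_k,N_0,\alpha,\kappa,\eta^{\mathrm s}_k,\eta^{\mathrm e},P_0,T,B_{\max},P_{\mathrm{umax}},P_{\mathrm{dmax}},F_{\max},D^{\mathrm s}_k$ are positive reals; $\rho\in(0,1)$; for each $k$, $n_k\ge1$ is an integer, $\mathbf\Phi_k$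 is a fixed real $n_k\times n_k$ matrix with nonzero determinant, $\mathbf V_k$ is the covariance matrix of a zero-mean Gaussian vector $\mathbf v_k\in\mathbb R^{n_k}$, $N(\mathbf v_k)=\frac{1}{2\pi e}\exp\left(\frac{2}{n_k}h(\mathbf v_k)\right)$ is its entropy power ($h$ is differential entropy), and $\mathbf M_k,\mathbf S_k$ are fixed positive semidefinite real $n_k\times n_k$ matrices (from Riccati equations). Only the fixed numbers $n_kN(\mathbf v_k)|\det\mathbf M_k|^{1/n_k}\ge0$, $\operatorname{tr}(\mathbf V_k\mathbf S_k)\ge0$ and $\log_2|\det\mathbf\Phi_k|$ enter. *)

(* Defs.v *)
From HB Require Import structures.
From mathcomp Require Import all_boot all_order all_algebra.
From mathcomp Require Import all_classical all_reals all_analysis.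

Set Implicit Arguments.
Unset Strict Implicit.
Unset Printing Implicit Defensive.

Import Order.TTheory GRing.Theory Num.Theory.
Import numFieldNormedType.Exports.

Local Open Scope classical_set_scope.
Local Open Scope ring_scope.

Section LebesgueTuple.
Context {R : realType}.

Definition cons_pair n (z : R * n.-tuple R) : n.+1.-tuple R :=
  [tuple of z.1 :: z.2].

Lemma measurable_cons_pair n : measurable_fun [set: R * n.-tuple R] (@cons_pair n).
Proof. exact: measurable_cons. Qed.

Section ConsMeasure.
Variables (n : nat) (m : {sigma_finite_measure set (n.-tuple R) -> \bar R}).

Definition cons_measure : set (n.+1.-tuple R) -> \bar R :=
  pushforward (lebesgue_measure \x m)%E (@cons_pair n).

Let pushforward_cons : {measure set (n.+1.-tuple R) -> \bar R} :=
  measure_function_pushforward__canonical__measure_function_Measure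
    (lebesgue_measure \x m)%E (@measurable_cons_pair n).

HB.instance Definition _ := Measure.copy cons_measure pushforward_cons.

Lemma cons_measureX (A : set R) (B : set (n.-tuple R)) :
  measurable A -> measurable B ->
  cons_measure [set t | A (thead t) /\ B [tuple of behead t]] =
  (lebesgue_measure A * m B)%E.
Proof.
move=> mA mB; rewrite /cons_measure /pushforward -product_measure1E//.
congr (_ \x _)%E; apply/seteqP; split=> -[x t] /= [].
  by rewrite theadE => ? Bt; split=> //; congr B: Bt; exact/val_inj.
by move=> Ax Bt; split=> //; congr B: Bt; exact/val_inj.
Qed.

Let sigma_finite_cons_measure : sigma_finite [set: n.+1.-tuple R] cons_measure.
Proof.
have /sigma_finiteP[F [TF ndF Foo]] := sigma_finiteT (@lebesgue_measure R).
have /sigma_finiteP[G [TG ndG Goo]] := sigma_finiteT m.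
exists (fun i => [set t | F i (thead t) /\ G i [tuple of behead t]]).
  apply/seteqP; split=> // t _.
  have [i _ Fi] : (\bigcup_i F i) (thead t) by rewrite -TF.
  have [j _ Gj] : (\bigcup_i G i) [tuple of behead t] by rewrite -TG.
  exists (maxn i j) => //=; split.
  - by move: Fi; exact/subsetPset/ndF/leq_maxl.
  - by move: Gj; exact/subsetPset/ndG/leq_maxr.
move=> i; have [mF Fi] := Foo i; have [mG Gi] := Goo i; split; last first.
  by rewrite cons_measureX// lte_mul_pinfty// ge0_fin_numE.
apply: measurableI.
- rewrite -[X in measurable X]setTI; exact: measurable_tnth.
- rewrite -[X in measurable X]setTI; exact: measurable_behead.
Qed.

HB.instance Definition _ := Measure_isSigmaFinite.Build _ _ _ cons_measure
  sigma_finite_cons_measure.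

End ConsMeasure.

(* Lebesgue measure on R^n, with R^n.+1 read as R x R^n. *)
Fixpoint lebesgue_tuple n : {sigma_finite_measure set (n.-tuple R) -> \bar R} :=
  match n with
  | 0 => \d_[tuple]
  | n'.+1 => cons_measure (lebesgue_tuple n')
  end.

Lemma lebesgue_tuple_box n (A : 'I_n -> set R) :
  (forall i, measurable (A i)) ->
  lebesgue_tuple n [set t | forall i, A i (tnth t i)] =
  (\prod_(i < n) lebesgue_measure (A i))%E.
Proof.
elim: n A => [|n IH] A mA.
  by rewrite big_ord0 /= diracE mem_set// => -[].
rewrite big_ord_recl -IH// -cons_measureX//; last first.
  rewrite [X in measurable X](_ : _ =
    \bigcap_i ((fun t : n.-tuple R => tnth t i) @^-1` A (lift ord0 i))); last first.
    apply/seteqP; split=> t /= At i; [move=> _; exact: At|exact: At i I].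
  apply: fin_bigcap_measurable => [|i _]; first exact: finite_finset.
  by rewrite -[X in measurable X]setTI; exact: measurable_tnth.
congr (cons_measure _ _); apply/seteqP; split=> t /=.
  move=> At; split; first exact: At.
  by move=> i; have := At (lift ord0 i); rewrite [in tnth t _](tuple_eta t) tnthS.
move=> [A0 At] i; case: (unliftP ord0 i) => [j ->|-> //].
by rewrite (tuple_eta t) tnthS.
Qed.

End LebesgueTuple.

Section GaussianVectors.
Context {R : realType} {d : measure_display} {T : measurableType d}.
Variable P : probability T R.

(* A point mass counts as normal (zero variance): [normal_prob m 0] is not a
   Dirac measure. *)
Definition normal_rv (Y : T -> R) : Prop :=
  (exists m, forall A : set R, measurable A -> pushforward P Y A = \d_m A) \/
  (exists m s, s != 0 /\
    forall A : set R, measurable A -> pushforward P Y A = normal_prob m s A).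

Definition gaussian_vector n (X : {RV P >-> n.-tuple R}) : Prop :=
  forall a : 'I_n -> R, normal_rv (fun w => \sum_(i < n) a i * tnth (X w) i).

Definition zero_mean n (X : {RV P >-> n.-tuple R}) : Prop :=
  forall i, 'E_P[fun w => tnth (X w) i]%E = 0%E.

Definition covariance_mx n (X : {RV P >-> n.-tuple R}) : 'M[R]_n :=
  \matrix_(i, j)
    fine (covariance P (fun w => tnth (X w) i) (fun w => tnth (X w) j)).

(* The entropy of a law with no density (e.g. a Gaussian vector with singular
   covariance) is -oo, so that its entropy power is 0. *)
Definition differential_entropy n (X : {RV P >-> n.-tuple R}) : \bar R :=
  let mu := lebesgue_tuple n in
  let nu := charge_of_finite_measure (distribution P X) in
  let f := Radon_Nikodym nu mu in
  if `[< nu `<< mu >] then (- \int[mu]_x (f x * lne (f x)))%E else -oo%E.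

Definition entropy_power n (X : {RV P >-> n.-tuple R}) : R :=
  (2 * pi * expR 1)^-1 *
  fine (expeR ((2 / n%:R)%:E * differential_entropy X)%E).

End GaussianVectors.

Definition psdmx {R : realType} n (A : 'M[R]_n) : Prop :=
  A^T = A /\ forall x : 'cV[R]_n, 0 <= (x^T *m A *m x) 0 0.

Definition log2 {R : realType} (x : R) : R := ln x / ln 2.

Record params (R : realType) (d : measure_display) (Omega : measurableType d)
    (P : probability Omega R) (K : nat) := Params {
  g_u : 'I_K -> R;
  g_d : 'I_K -> R;
  N_0 : R;
  alpha : R;
  kappa : R;
  eta_s : 'I_K -> R;
  eta_e : R;
  P_0 : R;
  T_tot : R;
  B_max : R;
  P_umax : R;
  P_dmax : R;
  F_max : R;
  D_s : 'I_K -> R;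
  rho : R;
  n_ : 'I_K -> nat;
  Phi : forall k, 'M[R]_(n_ k);
  M_ : forall k, 'M[R]_(n_ k);
  S_ : forall k, 'M[R]_(n_ k);
  v_ : forall k, {RV P >-> (n_ k).-tuple R} }.

Definition valid_params (R : realType) (d : measure_display)
    (Omega : measurableType d) (P : probability Omega R) (K : nat)
    (c : params P K) : Prop :=
  [/\ (0 < K)%N,
      forall k, [/\ 0 < g_u c k, 0 < g_d c k, 0 < eta_s c k & 0 < D_s c k],
      [/\ 0 < N_0 c, 0 < alpha c, 0 < kappa c, 0 < eta_e c & 0 < rho c < 1],
      [/\ 0 < P_0 c, 0 < T_tot c & 0 < B_max c] /\
      [/\ 0 < P_umax c, 0 < P_dmax c & 0 < F_max c] &
      forall k, [/\ (0 < n_ c k)%N, \det (Phi c k) != 0,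
        psdmx (M_ c k), psdmx (S_ c k) &
        gaussian_vector (v_ c k) /\ zero_mean (v_ c k)]].

Record allocation (R : realType) (K : nat) := Allocation {
  E_u : 'I_K -> R;
  E_c : 'I_K -> R;
  E_d : 'I_K -> R;
  t_u : 'I_K -> R;
  t_c : 'I_K -> R;
  t_d : 'I_K -> R;
  B_ : 'I_K -> R;
  s_u : 'I_K -> R;
  s_d : 'I_K -> R;
  D_ : 'I_K -> R;
  l_ : 'I_K -> R }.

Section Problems.
Context {R : realType} {d : measure_display} {Omega : measurableType d}.
Context {P : probability Omega R} {K : nat}.
Variable c : params P K.
Implicit Types (x : allocation R K) (k : 'I_K).

(* The matrix V_k is the covariance matrix of v_k. *)
Definition trVS k : R := \tr (covariance_mx (v_ c k) *m S_ c k).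

Definition D_u x k : R :=
  s_u x k * log2 (1 + g_u c k * E_u x k / (s_u x k * N_0 c)).

Definition D_c x k : R :=
  t_c x k * (E_c x k / (alpha c ^+ 3 * kappa c * t_c x k)) `^ (1 / 3).

Definition D_d x k : R :=
  s_d x k * log2 (1 + g_d c k * E_d x k / (s_d x k * N_0 c)).

Definition domain x : Prop := forall k,
  [/\ [/\ 0 < E_u x k, 0 < E_c x k & 0 < E_d x k],
      [/\ 0 < t_u x k, 0 < t_c x k & 0 < t_d x k],
      [/\ 0 < B_ x k, 0 < s_u x k & 0 < s_d x k] &
      trVS k < l_ x k].

Definition rate_bound x k : R :=
  log2 `|\det (Phi c k)| +
  (n_ c k)%:R / 2 *
    log2 (1 + (n_ c k)%:R * entropy_power (v_ c k) *
                `|\det (M_ c k)| `^ (1 / (n_ c k)%:R) /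
              (l_ x k - trVS k)).

Definition common_constraints x : Prop :=
  [/\ forall k, rate_bound x k <= D_ x k,
      (forall k, D_ x k <=
         Num.min (rho c * D_s c k)
           (Num.min (rho c * D_u x k) (Num.min (rho c * D_c x k) (D_d x k)))),
      [/\ \sum_(k < K) B_ x k <= B_max c,
          (forall k, t_u x k + t_c x k + t_d x k <= T_tot c) &
          \sum_(k < K) t_c x k <= T_tot c],
      \sum_(k < K) (E_u x k / eta_s c k + (E_c x k + E_d x k) / eta_e c)
        <= P_0 c * T_tot c &
      forall k, [/\ E_u x k / t_u x k <= P_umax c, E_d x k / t_d x k <= P_dmax c &
        (E_c x k / (kappa c * t_c x k)) `^ (1 / 3) <= F_max c]].

Definition feasible : set (allocation R K) := [set x |
  [/\ domain x, common_constraints x &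
      forall k, s_u x k <= t_u x k * B_ x k /\ s_d x k <= t_d x k * B_ x k]].

Definition approx_feasible (s_u0 s_d0 : 'I_K -> R) : set (allocation R K) := [set x |
  [/\ domain x, common_constraints x &
      forall k,
        (s_u x k - s_u0 k) / s_u0 k + ln (s_u0 k)
          - ln (t_u x k) - ln (B_ x k) <= 0 /\
        (s_d x k - s_d0 k) / s_d0 k + ln (s_d0 k)
          - ln (t_d x k) - ln (B_ x k) <= 0]].

End Problems.

Definition objective {R : realType} {K : nat} (x : allocation R K) : R :=
  \sum_(k < K) l_ x k.

Definition optimal_solution {R : realType} {K : nat} (F : set (allocation R K))
    (x : allocation R K) : Prop :=
  F x /\ forall y, F y -> objective x <= objective y.

Definition optimal_value {R : realType} {K : nat} (F : set (allocation R K)) : R :=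
  inf [set objective y | y in F].

(* Main.v *)
(* Since ln z <= z - 1, the constraint of (P_i) is the tangent-line bound of
   ln s at s_(i-1), so it implies ln s <= ln t + ln B, i.e. s <= t B; it is tight
   at s = s_(i-1). Hence (P_i) restricts (P), and x_(i-1) stays feasible for
   (P_i): the optimal values are nonincreasing, and they are bounded below
   because l_k > tr(V_k S_k). *)
Require Import Defs.
From mathcomp Require Import all_boot all_order all_algebra.
From mathcomp Require Import all_classical all_reals all_analysis.
From mathcomp Require Import lra.

Import Order.TTheory GRing.Theory Num.Theory.
Import numFieldNormedType.Exports.
Local Open Scope classical_set_scope.
Local Open Scope ring_scope.

(** Concavity of [ln]: this is [ln (1 + z) <= z] at [z = s / s0 - 1], where [z > -1] because the
    quotient is positive. *)
Lemma ln_le_tangent (R : realType) (s s0 : R) : 0 < s -> 0 < s0 ->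
  ln s <= (s - s0) / s0 + ln s0.
Proof.
move=> s_gt0 s0_gt0.
have q_gt0 : 0 < s / s0 by rewrite divr_gt0.
have -> : (s - s0) / s0 = s / s0 - 1 by rewrite mulrBl divff ?gt_eqF.
have : ln (1 + (s / s0 - 1)) <= s / s0 - 1 by apply: le_ln1Dx; lra.
by rewrite addrC subrK ln_div ?posrE//; lra.
Qed.

Lemma le_mul_of_tangent (R : realType) (s s0 t B : R) :
  0 < s -> 0 < s0 -> 0 < t -> 0 < B ->
  (s - s0) / s0 + ln s0 - ln t - ln B <= 0 -> s <= t * B.
Proof.
move=> s_gt0 s0_gt0 t_gt0 B_gt0 tangent_le.
rewrite -ler_ln ?posrE ?mulr_gt0// lnM ?posrE//.
by have := @ln_le_tangent _ _ _ s_gt0 s0_gt0; lra.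
Qed.

Lemma tangent_of_le_mul (R : realType) (s t B : R) :
  0 < s -> 0 < t -> 0 < B -> s <= t * B ->
  (s - s) / s + ln s - ln t - ln B <= 0.
Proof.
move=> s_gt0 t_gt0 B_gt0.
rewrite -ler_ln ?posrE ?mulr_gt0// lnM ?posrE// subrr mul0r; lra.
Qed.

(** [inf] is meaningful only for a nonempty set bounded below; the minimizer [x] supplies both the
    member and the bound. *)
Lemma optimal_valueE (R : realType) (K : nat) (F : set (allocation R K)) x :
  optimal_solution F x -> optimal_value F = objective x.
Proof.
move=> [Fx x_min]; apply/eqP; rewrite eq_le; apply/andP; split.
- apply: ge_inf; last by exists x.
  by exists (objective x) => _ [y Fy <-]; exact: x_min.
- apply: lb_le_inf; first by exists (objective x); exists x.
  by move=> _ [y Fy <-]; exact: x_min.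
Qed.

Section Approximation.
Context {R : realType} {d : measure_display} {Omega : measurableType d}.
Context {P : probability Omega R} {K : nat}.
Variable c : params P K.

Lemma approx_feasible_sub (x0 : allocation R K) : domain c x0 ->
  approx_feasible c (s_u x0) (s_d x0) `<=` feasible c.
Proof.
move=> dom0 x [dom cc tangent]; split=> // k.
have [_ _ [_ su0 sd0] _] := dom0 k.
have [_ [tu _ td] [B su sd] _] := dom k.
by have [hu hd] := tangent k; split;
  [exact: le_mul_of_tangent hu | exact: le_mul_of_tangent hd].
Qed.

Lemma feasible_approx (x : allocation R K) :
  feasible c x -> approx_feasible c (s_u x) (s_d x) x.
Proof.
move=> [dom cc bandwidth]; split=> // k.
have [_ [tu _ td] [B su sd] _] := dom k.
by have [hu hd] := bandwidth k; split; exact: tangent_of_le_mul.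
Qed.

(** The bound depends on [c] alone, so one constant serves all iterates. *)
Lemma objective_ge (x : allocation R K) :
  domain c x -> \sum_(k < K) trVS c k <= objective x.
Proof. by move=> dom; apply: ler_sum => k _; have [_ _ _ /ltW] := dom k. Qed.

End Approximation.

Theorem proposition2 (R : realType) (d : measure_display) (Omega : measurableType d)
    (P : probability Omega R) (K : nat) (c : params P K)
    (x : nat -> allocation R K) (L : nat -> R) :
  valid_params c ->
  feasible c (x 0%N) ->
  (forall i, (1 <= i)%N ->
     optimal_solution
       (approx_feasible c (s_u (x i.-1)) (s_d (x i.-1))) (x i)) ->
  (forall i, (1 <= i)%N ->
     L i = optimal_value (approx_feasible c (s_u (x i.-1)) (s_d (x i.-1)))) ->
  (forall i, (1 <= i)%N -> feasible c (x i)) /\ cvgn L.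
Proof.
move=> _ feas0 x_opt L_opt.
have feas i : feasible c (x i).
  (* The induction hypothesis gives the positivity of the [s_u] and [s_d] components of [x i],
     around which the next problem is linearized. *)
  elim: i => // i [dom _ _].
  have [approx _] := x_opt i.+1 isT.
  exact: approx_feasible_sub dom _ approx.
split=> [i _|]; first exact: feas.
have LE i : L i.+1 = objective (x i.+1).
  by rewrite L_opt//; exact: optimal_valueE (x_opt i.+1 isT).
(* [L 0] is arbitrary, so monotonicity can only be claimed from index 1 on; the shift leaves the
   limit unchanged. *)
suff : cvgn [sequence L n.+1]_n.
  move=> cvgL; apply/cvg_ex; exists (limn [sequence L n.+1]_n).
  by rewrite -cvg_shiftS.
apply: nonincreasing_is_cvgn.
- apply/nonincreasing_seqP => i /=; rewrite !LE.
  (* [x i.+1] competes in the problem built from its own components, which [x i.+2] solves. *)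
  by have [_ x_min] := x_opt i.+2 isT; exact/x_min/feasible_approx.
- exists (\sum_(k < K) trVS c k) => _ [i _ <-] /=; rewrite LE.
  by have [dom _ _] := feas i.+1; exact: objective_ge.
Qed.
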